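(* Let $D$ be an $F$-quasi-gauge on a set $X$ generating a $T_1$ quasi-uniformity $\mathcal U=\mathcal U_D$ (i.e. the topology $\tau(\mathcal U)$ is $T_1$), and let $\varphi:X\to\mathbb R\cup\{\infty\}$ be a proper bounded below function. Then the following statements are equivalent. 1. (Ekeland) There exists $z\in X$ such that for every $x\in X\setminus\{z\}$ there exists $d_x\in D$ with $\varphi(z)<\varphi(x)+d_x(x,z)$. 2. (Caristi–Kirk) Any mapping $f:X\to X$ satisfying $\varphi(f(x))+d(f(x),x)\le\varphi(x)$ for all $d\in D$ and all $x\in X$ has a fixed point in $X$. 3. (Takahashi) If for every $x\in X$ with $\varphi(x)>\inf\varphi(X)$ there exists $y\in X\setminus\{x\}$ such that $\varphi(y)+d(y,x)\le\varphi(x)$ for all $d\in D$, then there exists $z\in X$ with $\varphi(z)=\inf\varphi(X)$.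
   Context: An $F$-quasi-gauge on $X$ is a family $D$ of functions $d:X\times X\to\mathbb R$ such that: (QF1) $D$ is directed upward (for the pointwise order); (QF2) $d(x,y)\ge 0$ and $d(x,x)=0$ for all $d\in D$, $x,y\in X$; (QF3) for every $d\in D$ there is $d'\in D$ with $d'\ge d$ such that $d(x,y)\le d'(x,z)+d'(z,y)$ for all $x,y,z\in X$. It generates the quasi-uniformity $\mathcal U_D$ consisting of all $U\subseteq X\times X$ containing some $V_{d,\varepsilon}=\{(x,y)\in X\times X: d(x,y)<\varepsilon\}$, $d\in D$, $\varepsilon>0$. The topology $\tau(\mathcal U)$ has $\{U(x):U\in\mathcal U\}$, $U(x)=\{y\in X:(x,y)\in U\}$, as neighborhood basis at $x$. $\varphi$ is proper if $\{x:\varphi(x)<\infty\}\neq\emptyset$. *)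

(* Defs.v *)
From HB Require Import structures.
From mathcomp Require Import all_boot all_order all_algebra.
From mathcomp Require Import all_classical all_reals all_analysis.

Set Implicit Arguments.
Unset Strict Implicit.
Unset Printing Implicit Defensive.
Import Order.TTheory GRing.Theory Num.Theory.

Local Open Scope classical_set_scope.
Local Open Scope relation_scope.
Local Open Scope ring_scope.

(* Unlike a [uniformType], no closure under inversion of the entourages. *)
Record quasi_uniformity (X : Type) (E : set_system (X * X)) : Prop := {
  qu_filter : Filter E ;
  qu_diagonal : forall A, E A -> diagonal `<=` A ;
  qu_split : forall A, E A -> exists2 B, E B & B \; B `<=` A
}.

(* An alias of X carrying the topology induced by the quasi-uniformity E, in
   which the sets [xsection U x = [set y | (x, y) \in U]] for U in E form a
   neighborhood basis at x. *)
Definition quasi_uniform_space (X : Type) (E : set_system (X * X))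
  (_ : quasi_uniformity E) : Type := X.

Section QuasiUniformTopology.
Variables (X : Type) (E : set_system (X * X)) (hE : quasi_uniformity E).
Local Notation Q := (quasi_uniform_space hE).

HB.instance Definition _ := gen_eqMixin Q.
HB.instance Definition _ := gen_choiceMixin Q.
HB.instance Definition _ := hasNbhs.Build Q
  (fun x : X => filter_from E (fun U => xsection U x)).

Let nbhsQE (x : Q) : nbhs x = filter_from E (fun U => xsection U x).
Proof. by []. Qed.

Let nbhsQ_filter (x : Q) : ProperFilter (nbhs x).
Proof.
have EF := qu_filter hE; rewrite nbhsQE; apply: filter_from_proper; last first.
  by move=> A EA; exists x; apply/mem_set; exact: (qu_diagonal hE EA).
apply: filter_from_filter; first by exists setT; exact: filterT.
by move=> A B EA EB; exists (A `&` B); [exact: filterI|rewrite xsectionI].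
Qed.

Let nbhsQ_singleton (x : Q) (A : set Q) : nbhs x A -> A x.
Proof.
rewrite nbhsQE => -[U EU]; apply; apply/mem_set; exact: (qu_diagonal hE EU).
Qed.

Let nbhsQ_nbhs (x : Q) (A : set Q) : nbhs x A -> nbhs x (nbhs^~ A).
Proof.
rewrite nbhsQE => -[U /(qu_split hE)[V EV VVU] UA].
exists V => // y Vxy; rewrite nbhsQE; exists V => // z Vyz.
by apply/UA/mem_set/VVU; exists y; exact/set_mem.
Qed.

HB.instance Definition _ := Nbhs_isNbhsTopological.Build Q
  nbhsQ_filter nbhsQ_singleton nbhsQ_nbhs.

End QuasiUniformTopology.

Definition T1_quasi_uniformity (X : Type) (E : set_system (X * X))
  (hE : quasi_uniformity E) : Prop := accessible_space (quasi_uniform_space hE).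

(* As usual, an upward directed family is nonempty; otherwise the family would
   not generate any quasi-uniformity. *)
Record F_quasi_gauge (R : realType) (X : Type) (D : set (X -> X -> R)) : Prop := {
  qf_nonempty : D !=set0 ;
  qf_directed : forall d1 d2, D d1 -> D d2 ->
    exists2 d, D d & forall x y, d1 x y <= d x y /\ d2 x y <= d x y ;
  qf_ge0 : forall d, D d -> forall x y, 0 <= d x y ;
  qf_refl : forall d, D d -> forall x, d x x = 0 ;
  qf_triangle : forall d, D d -> exists2 d', D d' &
    (forall x y, d x y <= d' x y) /\
    (forall x y z, d x y <= d' x z + d' z y)
}.

Definition gauge_ball (R : realType) (X : Type) (d : X -> X -> R) (e : R) :
  set (X * X) := [set xy | d xy.1 xy.2 < e].

Definition gauge_entourage (R : realType) (X : Type) (D : set (X -> X -> R)) :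
  set_system (X * X) :=
  [set U | exists d e, [/\ D d, 0 < e & gauge_ball d e `<=` U]].

Lemma gauge_quasi_uniformity (R : realType) (X : Type) (D : set (X -> X -> R)) :
  F_quasi_gauge D -> quasi_uniformity (gauge_entourage D).
Proof.
case=> -[d0 Dd0] dir ge0 refl tri; split.
- split.
  + by exists d0, 1; split.
  + move=> U V [d1 [e1 [Dd1 e1_gt0 sU]]] [d2 [e2 [Dd2 e2_gt0 sV]]].
    have [d Dd le_d] := dir _ _ Dd1 Dd2.
    exists d, (Num.min e1 e2); split => //; first by rewrite lt_min e1_gt0.
    move=> [x y] /=; rewrite /gauge_ball /= lt_min => /andP[lt1 lt2].
    have [le1 le2] := le_d x y.
    by split; [apply: sU|apply: sV]; rewrite /gauge_ball /=;
      [apply: le_lt_trans lt1|apply: le_lt_trans lt2].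
  + move=> U V UV [d [e [Dd e_gt0 sU]]]; exists d, e; split => //.
    exact: subset_trans UV.
- move=> U [d [e [Dd e_gt0 sU]]] [x y] /= xy; apply: sU.
  by rewrite /gauge_ball /= -[y]xy /= refl.
- move=> U [d [e [Dd e_gt0 sU]]]; have [d' Dd' [_ d'tri]] := tri _ Dd.
  exists (gauge_ball d' (e / 2)).
    by exists d', (e / 2); split => //; rewrite divr_gt0.
  move=> [x y] [z /= xz zy]; apply: sU; rewrite /gauge_ball /=.
  by rewrite (le_lt_trans (d'tri x y z))// [e]splitr ltrD.
Qed.

Section Properties.
Local Open Scope ereal_scope.
Variables (R : realType) (X : Type).

Definition proper_function (phi : X -> \bar R) : Prop := exists x, phi x < +oo.

(* The bound is a real number: -oo bounds any function. *)
Definition bounded_below (phi : X -> \bar R) : Prop :=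
  exists m : R, forall x, m%:E <= phi x.

Variables (D : set (X -> X -> R)) (phi : X -> \bar R).

Definition ekeland : Prop :=
  exists z, forall x, x <> z ->
    exists2 d, D d & phi z < phi x + (d x z)%:E.

Definition caristi_kirk : Prop :=
  forall f : X -> X,
    (forall d, D d -> forall x, phi (f x) + (d (f x) x)%:E <= phi x) ->
    exists x, f x = x.

Definition takahashi : Prop :=
  (forall x, ereal_inf (range phi) < phi x ->
    exists2 y, y <> x & forall d, D d -> phi y + (d y x)%:E <= phi x) ->
  exists z, phi z = ereal_inf (range phi).

End Properties.

(* Main.v *)
Require Import Defs.
From mathcomp Require Import all_boot all_order all_algebra.
From mathcomp Require Import all_classical all_reals all_analysis.

Import Order.TTheory GRing.Theory Num.Theory.

Local Open Scope classical_set_scope.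
Local Open Scope ereal_scope.

(** Say that [y] lies below [x] when [phi y + d y x <= phi x] for all [d] in
    [D]. All three principles are statements about this relation: Ekeland's
    asserts that some [z] has nothing but itself below it, Caristi-Kirk's that
    no map sends every point to a different point below it, and Takahashi's
    that [phi] is minimized as soon as every non-minimizer has another point
    below it. A map as in Caristi-Kirk's principle cannot move an Ekeland
    point, and if [phi] has no minimizer then a choice of lower points is a map
    without fixed points; hence Ekeland implies Caristi-Kirk, which implies
    Takahashi.

    The way back from Takahashi to Ekeland rests on the separation of points. If
    Ekeland fails, every point has another point below it, so Takahashi gives a
    minimizer [z], and some [x <> z] lies below it. Since [phi z] is minimal and
    finite, [d x z = 0] for all [d] in [D], and then [z] belongs to every
    neighborhood of [x], against T1 ([T1_gauge_separated]). *)

(** When [d x y = 0] for all [d] in [D], every basic neighborhood of [x]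
    contains [y], so that no open set can separate [x] from [y]. *)
Lemma T1_gauge_separated (R : realType) (X : Type) (D : set (X -> X -> R))
    (hD : F_quasi_gauge D) (x y : X) :
  T1_quasi_uniformity (gauge_quasi_uniformity hD) ->
  (forall d, D d -> d x y = 0%R) -> x = y.
Proof.
pose Q : topologicalType := quasi_uniform_space (gauge_quasi_uniformity hD).
move=> T1 dxy0; apply: contrapT => xy.
have /T1[A [Aop Ax Ay]] : (x : Q) != (y : Q) by apply/eqP.
have [U [d [e [Dd e0 dU]]] UA] : nbhs (x : Q) A by apply: open_nbhs_nbhs; split;
  [|exact: set_mem].
move/set_mem: Ay; apply; apply: UA; apply/mem_set/dU.
by rewrite /gauge_ball /= dxy0.
Qed.

Lemma not_ekeland (R : realType) (X : Type) (D : set (X -> X -> R))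
    (phi : X -> \bar R) :
  ~ ekeland D phi ->
  forall z, exists2 x, x <> z & forall d, D d -> phi x + (d x z)%:E <= phi z.
Proof.
move=> nE z; apply: contrapT => nx; apply: nE; exists z => x xz.
apply: contrapT => nd; apply: nx; exists x => // d Dd.
by rewrite leNgt; apply/negP => lt_z; apply: nd; exists d.
Qed.

Lemma ekeland_caristi_kirk (R : realType) (X : Type) (D : set (X -> X -> R))
    (phi : X -> \bar R) :
  ekeland D phi -> caristi_kirk D phi.
Proof.
move=> [z zE] f fle; exists z; apply: contrapT => /zE[d Dd].
by rewrite ltNge fle.
Qed.

Lemma caristi_kirk_takahashi (R : realType) (X : Type) (D : set (X -> X -> R))
    (phi : X -> \bar R) :
  caristi_kirk D phi -> takahashi D phi.
Proof.
move=> CK below; apply: contrapT => nomin.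
have gt_inf x : ereal_inf (range phi) < phi x.
  rewrite lt_neqAle; apply/andP; split.
    by apply/eqP => infE; apply: nomin; exists x.
  by apply: ereal_inf_lbound; exists x.
have /choice[f fP] x : exists y, y <> x /\
    forall d, D d -> phi y + (d y x)%:E <= phi x.
  by have [y] := below x (gt_inf x); exists y.
have [x fx] := CK f (fun d Dd x => (fP x).2 d Dd).
by case: (fP x).
Qed.

Lemma takahashi_ekeland (R : realType) (X : Type) (D : set (X -> X -> R))
    (hD : F_quasi_gauge D) (phi : X -> \bar R) :
  T1_quasi_uniformity (gauge_quasi_uniformity hD) ->
  (forall x, phi x != -oo) -> proper_function phi ->
  takahashi D phi -> ekeland D phi.
Proof.
move=> T1 phiNy [x0 x0_lty] Tak; apply: contrapT => /not_ekeland below.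
have [z zmin] := Tak (fun x _ => below x).
have z_le x : phi z <= phi x by rewrite zmin; apply: ereal_inf_lbound; exists x.
have z_fin : phi z \is a fin_num.
  by rewrite fin_numE phiNy lt_eqF// (le_lt_trans (z_le x0)).
have [x xz x_below] := below z.
apply: xz; apply: (T1_gauge_separated _ _ _ _ _ _ T1) => d Dd.
apply/eqP; rewrite eq_le (qf_ge0 hD Dd) andbT -lee_fin.
rewrite -(leeD2lE _ _ z_fin) adde0.
by apply: le_trans (x_below d Dd); rewrite leeD2r.
Qed.

Theorem theorem5p1 (R : realType) (X : Type) (D : set (X -> X -> R))
    (hD : F_quasi_gauge D)
    (hT1 : T1_quasi_uniformity (gauge_quasi_uniformity hD))
    (phi : X -> \bar R) (phi_ninfty : forall x, phi x != -oo)
    (phi_proper : proper_function phi) (phi_bounded : bounded_below phi) :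
  [<-> ekeland D phi; caristi_kirk D phi; takahashi D phi].
Proof.
tfae.
- exact: ekeland_caristi_kirk.
- exact: caristi_kirk_takahashi.
- exact: (takahashi_ekeland _ _ _ hD).
Qed.
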